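(* Let $\mathcal{Q}_1$ be a code of length $n=2\ell$ defined by $\ell\times\ell$ binary circulant matrices $A_1$ and $B_1$ via the parity-check matrix $$H_1:=\begin{pmatrix}(A_1|B_1)&0\\0&(B_1^T|A_1^T)\end{pmatrix},$$ and let $a(x),b(x)$ be the polynomials isomorphic to $A_1,B_1$ respectively. Then one can construct a family of $[[n_m,k_m,d_m]]$ quantum codes $\mathcal{F}:=\{\mathcal{Q}_1,\dots,\mathcal{Q}_M\}$ such that: 1. The codes in $\mathcal{F}$ satisfy $n_{m+1}=n+2m\cdot r$ and $k_{m+1}\geq k_m$, for $m=1,\dots,M-1$ and $r$ an integer. 2. For $m=1,\dots,M-1$, $\mathcal{Q}_{m+1}$ is obtained from $\mathcal{Q}_m$ by setting $A_{m+1}=F(A_m)$ and $B_{m+1}=F(B_m)$, where, for a circulant matrix $C$ isomorphic to the polynomial $c(x)=c_0+c_1x+\dots+c_{s-1}x^{s-1}$ (with $s$ the size of $C$), $F(C)$ is the circulant matrix of size $s+r$ whose first column is $$(c_0,c_1,\dots,c_{j-1},\underbrace{0,\dots,0}_{r},c_j,c_{j+1},\dots,c_{s-1})^T,$$ with $0<j<\ell-1$. 3. $\mathcal{F}$ is a family of $t$-qLDPC codes with $t=\mathrm{wt}\,a(x)+\mathrm{wt}\,b(x)$.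
   Context: Circulant matrices: an $s\times s$ binary circulant matrix $P$ with first column $(p_0,\dots,p_{s-1})^T$ (each column being the cyclic downward shift of the previous one) is identified with the polynomial $p(x)=p_0+p_1x+\dots+p_{s-1}x^{s-1}$ in $\mathbb{F}_2[x]/(x^s-1)$ (the polynomial ''isomorphic to'' $P$). The weight $\mathrm{wt}\,p(x)$ is the number of non-zero coefficients of $p(x)$. CSS code: binary matrices $H_X,H_Z$ with $n$ columns satisfying $H_XH_Z^T=0$ over $\mathbb{F}_2$ define a quantum code of length $n$ with parity-check matrix $H=\begin{pmatrix}H_X&0\\0&H_Z\end{pmatrix}$ and dimension $k=n-\mathrm{rank}(H)$ (rank over $\mathbb{F}_2$). Its distance $d$ is the minimum weight of a Pauli operator commuting with all elements of the stabilizer group but not belonging to it. One writes $[[n,k,d]]$. The code $\mathcal{Q}_m$ determined by the square circulant matrices $A_m,B_m$ has parity-check matrix $H_m=\begin{pmatrix}(A_m|B_m)&0\\0&(B_m^T|A_m^T)\end{pmatrix}$, i.e. $H_X=(A_m|B_m)$ and $H_Z=(B_m^T|A_m^T)$. Sparsity and qLDPC: let $\{\mathcal{Q}_1,\mathcal{Q}_2,\dots\}$ be a family of CSS codes, $\mathcal{Q}_m$ being defined by a $(2\ell_m\times 2n_m)$ parity-check matrix $H_m$ (with $H_X,H_Z$ both of size $\ell_m\times n_m$) with no zero row and no zero column, maximum row Hamming weight $w_{\rm r}(m)$ and maximum column Hamming weight $w_{\rm c}(m)$. The family is $q(m)$-sparse if $w_{\rm r}(m)/n_m\le q(m)$ and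 $w_{\rm c}(m)/\ell_m\le q(m)$. If moreover $q(m)n_m\le t$ and $q(m)\ell_m\le t$ for a positive constant $t$, every code in the family is called a $t$-qLDPC code.
   Formalization: Item 3 with a single q(m) for rows and columns fails whenever wt a(x) ≠ wt b(x) (e.g. ℓ=3, a=1, b=1+x+x²); the formal theorem allows separate bounds for row and column sparsity, and asserts the single-q version when wt a(x) = wt b(x). *)

(* Defs.v *)
(* MathComp *)
From mathcomp Require Import all_boot all_order all_algebra.

Set Implicit Arguments.
Unset Strict Implicit.
Unset Printing Implicit Defensive.

Import Order.TTheory GRing.Theory Num.Theory.
Local Open Scope ring_scope.

(* Each column, the first one included, is the cyclic downward shift of the
   column on its left. *)
Definition is_circulant (s : nat) (C : 'M['F_2]_s) : Prop :=
  forall i k : 'I_s, C (ordS i) (ordS k) = C i k.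

(* The index 0 of 'I_s, available because 'I_s is inhabited by i. *)
Definition ord_zero (s : nat) (i : 'I_s) : 'I_s :=
  Ordinal (leq_ltn_trans (leq0n i) (ltn_ord i)).

Definition first_col (s : nat) (C : 'M['F_2]_s) : seq 'F_2 :=
  [seq C i (ord_zero i) | i <- enum 'I_s].

(* (i + (s - k)) %% s is i - k modulo s, as k < s. *)
Definition circulant_mx (s : nat) (c : seq 'F_2) : 'M['F_2]_s :=
  \matrix_(i < s, k < s) c`_((i + (s - k)) %% s).

Definition circ_poly (s : nat) (C : 'M['F_2]_s) : {poly 'F_2} :=
  Poly (first_col C).

Definition wt_poly (p : {poly 'F_2}) : nat := count (fun x => x != 0) p.

Definition circ_extend (j r s : nat) (C : 'M['F_2]_s) : 'M['F_2]_(s + r) :=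
  let c := first_col C in
  circulant_mx (s + r) (take j c ++ nseq r 0 ++ drop j c).

Record css := CSS {
  css_rows : nat;
  css_length : nat;
  css_HX : 'M['F_2]_(css_rows, css_length);
  css_HZ : 'M['F_2]_(css_rows, css_length)
}.

Definition css_condition (Q : css) : Prop := css_HX Q *m (css_HZ Q)^T = 0.

Definition parity_check (Q : css) :
    'M['F_2]_(css_rows Q + css_rows Q, css_length Q + css_length Q) :=
  block_mx (css_HX Q) 0 0 (css_HZ Q).

(* Under css_condition the rank is at most the length, so that the truncated
   subtraction is the subtraction of integers. *)
Definition css_dim (Q : css) : nat := css_length Q - \rank (parity_check Q).

(* An n-qubit Pauli operator, up to phase, is a row vector (u | v) of length
   n + n: it acts on qubit i as X^(u_i) Z^(v_i). *)
Definition pauli_weight (n : nat) (e : 'rV['F_2]_(n + n)) : nat :=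
  #|[set i : 'I_n | (lsubmx e 0 i != 0) || (rsubmx e 0 i != 0)]|.

Definition pauli_commute (n : nat) (e f : 'rV['F_2]_(n + n)) : bool :=
  lsubmx e *m (rsubmx f)^T + rsubmx e *m (lsubmx f)^T == 0.

(* Up to phase, the stabilizer group is the row space of parity_check Q. *)
Definition nontrivial_logical (Q : css) :
    {set 'rV['F_2]_(css_length Q + css_length Q)} :=
  [set e | [forall f : 'rV['F_2]_(css_length Q + css_length Q),
              (f <= parity_check Q)%MS ==> pauli_commute e f]
           && ~~ (e <= parity_check Q)%MS].

(* None when there is no nontrivial logical operator (k = 0), in which case the
   minimum is over the empty set. *)
Definition css_distance (Q : css) : option nat :=
  if [pick e in nontrivial_logical Q] is Some e0 then
    Some (pauli_weight [arg min_(e < e0 in nontrivial_logical Q) pauli_weight e])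
  else None.

Definition has_parameters (Q : css) (n k : nat) (d : option nat) : Prop :=
  [/\ css_length Q = n, css_dim Q = k & css_distance Q = d].

Record circ_pair := CircPair {
  cp_size : nat;
  cp_A : 'M['F_2]_cp_size;
  cp_B : 'M['F_2]_cp_size
}.

Definition gb_code (P : circ_pair) : css :=
  CSS (row_mx (cp_A P) (cp_B P)) (row_mx (cp_B P)^T (cp_A P)^T).

Definition circ_pair_extend (j r : nat) (P : circ_pair) : circ_pair :=
  CircPair (circ_extend j r (cp_A P)) (circ_extend j r (cp_B P)).

Definition no_zero_row (p q : nat) (H : 'M['F_2]_(p, q)) : Prop :=
  forall i, row i H != 0.

Definition no_zero_col (p q : nat) (H : 'M['F_2]_(p, q)) : Prop :=
  forall k, col k H != 0.

Definition max_row_weight (p q : nat) (H : 'M['F_2]_(p, q)) : nat :=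
  \max_(i < p) #|[set k : 'I_q | H i k != 0%R]|.

Definition max_col_weight (p q : nat) (H : 'M['F_2]_(p, q)) : nat :=
  \max_(k < q) #|[set i : 'I_p | H i k != 0%R]|.

(* Members of a family {Q 1, ..., Q M}; qr bounds the row densities and qc the
   column densities.  q-sparsity is the case qr = qc = q. *)
Definition sparse (M : nat) (Q : nat -> css) (qr qc : nat -> rat) : Prop :=
  forall m, (1 <= m <= M)%N ->
    let H := parity_check (Q m) in
    [/\ no_zero_row H, no_zero_col H,
        (max_row_weight H)%:R / (css_length (Q m))%:R <= qr m
      & (max_col_weight H)%:R / (css_rows (Q m))%:R <= qc m].

Definition qldpc_common (M : nat) (Q : nat -> css) (t : rat) : Prop :=
  0 < t /\ exists2 q : nat -> rat, sparse M Q q q &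
    forall m, (1 <= m <= M)%N ->
      q m * (css_length (Q m))%:R <= t /\ q m * (css_rows (Q m))%:R <= t.

(* Row and column densities may have different bounds; this says that row and
   column weights are at most t.  With one common bound q, as in qldpc_common,
   one gets max_col_weight * (css_length / css_rows) <= t, which for
   css_length = 2 * css_rows is twice as strong on columns: the codes
   of a pair (A, B) then satisfy it for t = wt a + wt b only if wt a = wt b. *)
Definition qldpc (M : nat) (Q : nat -> css) (t : rat) : Prop :=
  0 < t /\ exists qr qc : nat -> rat, sparse M Q qr qc /\
    forall m, (1 <= m <= M)%N ->
      qr m * (css_length (Q m))%:R <= t /\ qc m * (css_rows (Q m))%:R <= t.

(* Main.v *)
Require Import Defs.
From mathcomp Require Import all_boot all_order all_algebra.
From mathcomp Require Import perm ring.
Import Order.TTheory GRing.Theory Num.Theory.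
Local Open Scope ring_scope.

(* A vector in the left kernel of H_X = (A_m|B_m) is a sequence w of period
   s = ell + q, q = (m - 1) r, satisfying two linear recurrences with
   coefficients c_0, ..., c_(j-1), 0^q, c_j, ..., c_(ell-1), one for each of the
   two polynomials.  Modulo the period s these become recurrences with
   coefficients 0^j, c_j, ..., c_(ell-1), c_0, ..., c_(j-1), which depend neither
   on q nor on r.  A nonzero such recurrence has finitely many states over F_2, so
   there is one number r that is a period of all its periodic solutions.  With this r
   every solution of period s has period s + r as well, so the kernels grow with
   m.  As A^T = J A J for J the permutation i |-> -i, the kernel of H_Z has the
   same dimension as that of H_X, so k_m is twice the dimension of the latter. *)

(** * Linear recurrences over F_2 and a period common to their periodic solutions *)

Lemma F2_addrr (x : 'F_2) : x + x = 0.
Proof. by rewrite -mulr2n -mulr_natr pchar_Zp ?mulr0. Qed.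

(** The sequence is infinite, so indices are never reduced modulo its period and the same sequence
    can be tested against recurrences of different lengths. *)
Definition conv (e : seq 'F_2) (w : nat -> 'F_2) (k : nat) : 'F_2 :=
  \sum_(u < size e) e`_u * w (k + u)%N.

Lemma conv_cat x y w k : conv (x ++ y) w k = conv x w k + conv y w (k + size x).
Proof.
rewrite /conv size_cat big_split_ord /=; congr (_ + _); apply: eq_bigr => u _.
  by rewrite nth_cat ltn_ord.
by rewrite nth_cat ltnNge leq_addr /= addKn addnA.
Qed.

Lemma conv_nseq0 n w k : conv (nseq n 0) w k = 0.
Proof. by rewrite /conv big1 // => u _; rewrite nth_nseq if_same mul0r. Qed.

Lemma conv_seq1 x w k : conv [:: x] w k = x * w k.
Proof. by rewrite /conv big_ord1 /= addn0. Qed.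

Lemma conv_eq e w w' k l : (forall u, w (k + u)%N = w' (l + u)%N) ->
  conv e w k = conv e w' l.
Proof. by move=> ww'; apply: eq_bigr => u _; rewrite ww'. Qed.

Lemma convB e w w' k l :
  conv e (fun t => w (k + t)%N - w' (l + t)%N) 0 = conv e w k - conv e w' l.
Proof.
by rewrite /conv -sumrB; apply: eq_bigr => u _; rewrite mulrBr.
Qed.

(** Trailing zeros of [e] are stripped first; once the last coefficient is nonzero, it determines
    each term from the preceding ones. *)
Lemma recurrence_eq0 e w : has (fun x => x != 0) e ->
    (forall k, conv e w k = 0) -> (forall u, (u < size e)%N -> w u = 0) ->
  forall t, w t = 0.
Proof.
elim/last_ind: e => // e x IHe.
rewrite has_rcons size_rcons -cats1 => nz_e w_rec w0.
have [x0|x_neq0] := eqVneq x 0.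
  move: nz_e; rewrite x0 eqxx /= => nz_e.
  apply: IHe => // [k|u lt_u]; last by apply: w0; apply: ltnW.
  by move: (w_rec k); rewrite conv_cat conv_seq1 x0 mul0r addr0.
elim/ltn_ind => t IHt; have [lt_t|le_t] := ltnP t (size e).
  by apply: w0; apply: ltnW.
have := w_rec (t - size e)%N; rewrite conv_cat conv_seq1 subnK //.
rewrite [conv e w _]big1 ?add0r => [/eqP|u _].
  by rewrite mulf_eq0 (negbTE x_neq0) => /eqP.
by rewrite IHt ?mulr0 // -[X in (_ < X)%N](subnK le_t) ltn_add2l.
Qed.

(** A recurrence with [n] coefficients has windows of length [n] as states. The factorial is
    divisible by every possible distance between the first repeated windows. *)
Definition common_period (n : nat) : nat := (#|{: n.-tuple 'F_2}|)`!.

Lemma periodic_mul (w : nat -> 'F_2) p n :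
  (forall t, w (t + p)%N = w t) -> forall t, w (t + n * p)%N = w t.
Proof. by move=> wp; elim: n => [|n IHn] t; rewrite ?addn0 // mulSn addnA IHn. Qed.

(** Two windows coincide by the pigeonhole principle. The difference of the two shifted sequences
    satisfies the recurrence and starts with zeros, hence vanishes. *)
Lemma recurrence_period e w s : has (fun x => x != 0) e -> (0 < s)%N ->
    (forall t, w (t + s)%N = w t) -> (forall k, conv e w k = 0) ->
  forall t, w (t + common_period (size e))%N = w t.
Proof.
move=> nz_e s_gt0 ws w_rec.
pose T := {: (size e).-tuple 'F_2}.
(* One window more than there are states, with distances at most [#|T|]. *)
pose W (i : 'I_(#|T|.+1)) := [tuple w (i + u)%N | u < size e].
have /injectivePn[i1 [i2 neq_i eqW]] : ~~ injectiveb W.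
  apply/negP => /injectiveP /leq_card.
  by rewrite card_ord ltnn.
wlog lt_i : i1 i2 neq_i eqW / (i1 < i2)%N.
  move=> wl; case: (ltngtP i1 i2) => [|lt_i|/val_inj eq_i]; first exact: wl.
    by apply: (wl i2 i1) => //; rewrite eq_sym.
  by rewrite eq_i eqxx in neq_i.
have wD t : w (i1 + t)%N = w (i2 + t)%N.
  apply/eqP; rewrite -subr_eq0; apply/eqP.
  move: t; apply: (recurrence_eq0 e) => // [k|u lt_u].
    rewrite -[RHS](subr0 0) -{1}(w_rec (i1 + k)%N) -(w_rec (i2 + k)%N) -convB.
    by apply: conv_eq => u; rewrite add0n !addnA.
  have := congr1 (fun x => tnth x (Ordinal lt_u)) eqW.
  by rewrite !tnth_mktuple => ->; rewrite subrr.
(* [wD] gives the period [i2 - i1] only from index [i1] on; adding [i1] times the period [s] moves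
   any [t] into that range. *)
have wp t : w (t + (i2 - i1))%N = w t.
  have /subnKC Eu : (i1 <= t + i1 * s)%N.
    exact: leq_trans (leq_pmulr _ s_gt0) (leq_addl _ _).
  rewrite -(periodic_mul w s i1 ws t) -(periodic_mul w s i1 ws (_ + _)%N).
  by rewrite addnAC -{1}Eu addnAC (subnKC (ltnW lt_i)) -wD Eu.
have /dvdnP[q Eq] : (i2 - i1 %| common_period (size e))%N.
  by apply: dvdn_fact; rewrite subn_gt0 lt_i (leq_trans (leq_subr _ _)) // -ltnS.
by rewrite Eq; apply: periodic_mul.
Qed.

(** * Circulant matrices and their first columns *)

Lemma circulant_mxE s c (i k : 'I_s.+1) : circulant_mx s.+1 c i k = c`_(i - k)%R.
Proof. by rewrite mxE; congr (_`_ _); rewrite /= modnDmr. Qed.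

Lemma nth_first_col s (C : 'M['F_2]_s.+1) (i : 'I_s.+1) :
  (first_col C)`_i = C i 0.
Proof.
rewrite (nth_map 0) ?size_enum_ord // nth_ord_enum; congr (C i _).
exact: val_inj.
Qed.

Lemma size_first_col s (C : 'M['F_2]_s) : size (first_col C) = s.
Proof. by rewrite size_map size_enum_ord. Qed.

Lemma first_col_circulant s c : size c = s -> first_col (circulant_mx s c) = c.
Proof.
case: s => [|s] sz_c.
  by rewrite (size0nil sz_c); apply: size0nil; rewrite size_first_col.
apply: (@eq_from_nth _ 0); rewrite size_first_col ?sz_c // => i lt_i.
by rewrite (nth_first_col _ _ (Ordinal lt_i)) circulant_mxE subr0.
Qed.

Lemma inZpD s m n : inZp (m + n) = inZp m + inZp n :> 'I_s.+1.
Proof. by apply: val_inj; rewrite /= modnDm. Qed.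

Lemma is_circulantE s (C : 'M['F_2]_s) :
  is_circulant C -> C = circulant_mx s (first_col C).
Proof.
case: s C => [|s] C circC; first by apply/matrixP => -[].
have CD n (i : 'I_s.+1) : C (i + inZp n) (inZp n) = C i 0.
  elim: n i => [|n IHn] i.
    by rewrite [inZp 0](_ : _ = 0) ?addr0 //; apply: val_inj; rewrite /= mod0n.
  have ordSE (x : 'I_s.+1) : ordS x = x + inZp 1.
    by apply: val_inj; rewrite /= modnDmr addn1.
  by rewrite -(IHn i) -[RHS]circC !ordSE -addrA -inZpD addn1.
apply/matrixP => i k; rewrite circulant_mxE nth_first_col -(CD k) valZpK.
by rewrite subrK.
Qed.

(** * Insertion of zeros and its iteration *)

Definition insert0 (j q : nat) (c : seq 'F_2) : seq 'F_2 :=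
  take j c ++ nseq q 0 ++ drop j c.

Lemma size_insert0 j q c : size (insert0 j q c) = (size c + q)%N.
Proof.
rewrite -[in RHS](cat_take_drop j c) !size_cat size_nseq.
by rewrite addnA addnAC.
Qed.

(** The second insertion takes place at the start of the first gap, so the two gaps merge. *)
Lemma insert0_add j q r c : (j <= size c)%N ->
  insert0 j r (insert0 j q c) = insert0 j (q + r) c.
Proof.
move=> le_j; have sz_take : size (take j c) = j by rewrite size_takel.
by rewrite /insert0 take_size_cat // drop_size_cat // addnC nseqD -!catA.
Qed.

Lemma insert0_0 j c : insert0 j 0 c = c.
Proof. exact: cat_take_drop. Qed.

Lemma count_insert0 j q c :
  count (fun x => x != 0) (insert0 j q c) = count (fun x => x != 0) c.
Proof.
by rewrite !count_cat count_nseq eqxx mul0n -count_cat cat_take_drop.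
Qed.

Definition circ_code (s : nat) (c d : seq 'F_2) : circ_pair :=
  CircPair (circulant_mx s c) (circulant_mx s d).

Lemma circ_pair_extend_code j r s c d : size c = s -> size d = s ->
  circ_pair_extend j r (circ_code s c d) =
  circ_code (s + r) (insert0 j r c) (insert0 j r d).
Proof.
by move=> sc sd; rewrite /circ_pair_extend /circ_extend /= !first_col_circulant.
Qed.

Lemma iter_circ_pair_extend j r s c d q :
    (j <= s)%N -> size c = s -> size d = s ->
  iter q (circ_pair_extend j r) (circ_code s c d) =
  circ_code (s + q * r) (insert0 j (q * r) c) (insert0 j (q * r) d).
Proof.
move=> le_j sc sd; elim: q => [|q IHq]; first by rewrite !insert0_0 addn0.
rewrite iterS IHq circ_pair_extend_code ?size_insert0 ?sc ?sd //.
by rewrite !insert0_add ?sc ?sd // -addnA -mulSnr.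
Qed.

(** * Left kernels of pairs of circulants as spaces of periodic solutions *)

Lemma mulmx_circulant s c (v : 'rV_s.+1) k : size c = s.+1 ->
  (v *m circulant_mx s.+1 c) 0 (inZp k) = conv c (fun t => v 0 (inZp t)) k.
Proof.
move=> sz_c; rewrite mxE /conv sz_c (reindex_inj (addIr (inZp k))) /=.
apply: eq_bigr => u _; rewrite circulant_mxE addrK mulrC inZpD addrC.
by rewrite valZpK.
Qed.

(* The recurrence read off from insert0 j q c on sequences of period
   size c + q: shifting it by size c and using the periodicity moves the
   inserted gap away, so that q disappears. *)
Definition wrap (j : nat) (c : seq 'F_2) : seq 'F_2 :=
  nseq j 0 ++ drop j c ++ take j c.

Lemma conv_insert0 j q c w : (j <= size c)%N ->
    (forall t, w (t + (size c + q))%N = w t) ->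
  (forall k, conv (insert0 j q c) w k = 0) <->
  (forall k, conv (wrap j c) w k = 0).
Proof.
move=> le_j w_per; have sz_take : size (take j c) = j by rewrite size_takel.
have ins k : conv (insert0 j q c) w k =
    conv (take j c) w k + conv (drop j c) w (k + j + q)%N.
  by rewrite !conv_cat conv_nseq0 add0r sz_take size_nseq.
have wrapE k : conv (wrap j c) w k =
    conv (take j c) w (k + size c)%N + conv (drop j c) w (k + j)%N.
  rewrite /wrap !conv_cat conv_nseq0 add0r size_nseq size_drop addrC -addnA.
  by rewrite subnKC.
split=> w_rec k.
  rewrite wrapE -(w_rec (k + size c)%N) ins; congr (_ + _).
  by apply: conv_eq => u; rewrite -[LHS]w_per; congr w; ring.
(* Conversely the shift is by [q], as [q + size c] is the period. *)
rewrite ins -(w_rec (k + q)%N) wrapE [(k + q + j)%N]addnAC; congr (_ + _).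
by apply: conv_eq => u; rewrite -[LHS]w_per; congr w; ring.
Qed.

Lemma has_wrap j c : has (fun x => x != 0 :> 'F_2) c ->
  has (fun x => x != 0 :> 'F_2) (wrap j c).
Proof.
rewrite -[X in has _ X -> _](cat_take_drop j c) /wrap !has_cat => /orP[] ->;
by rewrite !orbT.
Qed.

Lemma row_mx_circulant_eq0 s c d (v : 'rV_s.+1) :
    size c = s.+1 -> size d = s.+1 ->
  let w t := v 0 (inZp t) in
  v *m row_mx (circulant_mx s.+1 c) (circulant_mx s.+1 d) = 0 <->
  (forall k, conv c w k = 0) /\ (forall k, conv d w k = 0).
Proof.
move=> sz_c sz_d w; rewrite mul_mx_row -row_mx0.
split=> [/eq_row_mx[vc vd]|[wc wd]].
  by split=> k; rewrite -mulmx_circulant // ?vc ?vd mxE.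
by congr row_mx; apply/rowP => k; rewrite -[k]valZpK mulmx_circulant ?mxE.
Qed.

(** Periodic extension is injective because [s <= s'], and by [step] it maps the first kernel into
    the second. *)
Lemma rank_ker_circulant_le s s' c d c' d' : (s <= s')%N ->
    size c = s.+1 -> size d = s.+1 -> size c' = s'.+1 -> size d' = s'.+1 ->
    (forall w, (forall t, w (t + s.+1)%N = w t) ->
       (forall k, conv c w k = 0) /\ (forall k, conv d w k = 0) ->
     [/\ forall t, w (t + s'.+1)%N = w t,
         forall k, conv c' w k = 0 & forall k, conv d' w k = 0]) ->
  (\rank (kermx (row_mx (circulant_mx s.+1 c) (circulant_mx s.+1 d))) <=
   \rank (kermx (row_mx (circulant_mx s'.+1 c') (circulant_mx s'.+1 d'))))%N.
Proof.
move=> le_s sz_c sz_d sz_c' sz_d' step.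
(* E extends a vector of length s.+1 periodically to length s'.+1. *)
pose E : 'M['F_2]_(s.+1, s'.+1) := \matrix_(i, k) (i == inZp k)%:R.
have mulE (v : 'rV_s.+1) k : (v *m E) 0 k = v 0 (inZp k).
  rewrite mxE (bigD1 (inZp k)) //= mxE eqxx mulr1 big1 ?addr0 // => i ne_i.
  by rewrite mxE (negbTE ne_i) mulr0.
have freeE : row_free E.
  apply: inj_row_free => v vE0; apply/rowP => i.
  have le_s1 : (s.+1 <= s'.+1)%N by [].
  by move/rowP/(_ (widen_ord le_s1 i)): vE0; rewrite mulE valZpK !mxE.
rewrite -(mxrankMfree _ freeE); apply/mxrankS/row_subP => i.
rewrite row_mul; apply/sub_kermxP.
set v := row i _; pose w t := v 0 (inZp t).
have /(row_mx_circulant_eq0 _ _ _ _ sz_c sz_d) w_rec :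
    v *m row_mx (circulant_mx s.+1 c) (circulant_mx s.+1 d) = 0.
  by apply/sub_kermxP; apply: row_sub.
have w_per t : w (t + s.+1)%N = w t.
  by congr (v _ _); apply: val_inj; rewrite /= modnDr.
have [w_per' wc' wd'] := step w w_per w_rec.
(* Repeating the extended vector with period [s'.+1] gives back [w], which has that period by
   [step]. *)
have wE t : (v *m E) 0 (inZp t) = w t.
  rewrite mulE -/(w _) [in RHS](divn_eq t s'.+1) addnC.
  by rewrite (periodic_mul w _ _ w_per').
apply/row_mx_circulant_eq0 => //; split=> k.
  by rewrite -(wc' k); apply: conv_eq => u; apply: wE.
by rewrite -(wd' k); apply: conv_eq => u; apply: wE.
Qed.

(** Both gap lengths lead to the same recurrences [wrap j c] and [wrap j d], so only the period of
    the sequence has to be enlarged. *)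
Lemma rank_ker_insert0_le j q ell c d : (0 < ell)%N -> (j <= ell)%N ->
    size c = ell -> size d = ell ->
    has (fun x => x != 0) c -> 
  let H p := row_mx (circulant_mx (ell + p) (insert0 j p c))
                    (circulant_mx (ell + p) (insert0 j p d)) in
  (\rank (kermx (H q)) <=
     \rank (kermx (H (q + common_period (ell + j))%N)))%N.
Proof.
move=> ell_gt0 le_j sz_c sz_d nz_c /=.
set r := common_period _.
have [s Es] : exists s, (ell + q = s.+1)%N.
  by case: (ell) ell_gt0 => // n; exists (n + q)%N.
have [s' Es'] : exists s', (ell + (q + r) = s'.+1)%N.
  by rewrite addnA Es addSn; eexists.
have sz p x : size x = ell -> size (insert0 j p x) = (ell + p)%N.
  by move=> sz_x; rewrite size_insert0 sz_x.
have szq x : size x = ell -> size (insert0 j q x) = s.+1 by move/(sz q) ->.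
have szr x : size x = ell -> size (insert0 j (q + r) x) = s'.+1.
  by move/(sz (q + r)%N) ->.
rewrite Es Es'; apply: rank_ker_circulant_le; rewrite ?szq ?szr //.
  by rewrite -ltnS -Es -Es' addnA leq_addr.
rewrite -Es -Es' => w w_per [].
rewrite !conv_insert0 ?sz_c ?sz_d // => wc wd.
(* The argument [ell + j] of [common_period] is the length of [wrap j c], whose [j] leading zeros
   count as coefficients. *)
have w_perr t : w (t + r)%N = w t.
  rewrite /r (_ : ell + j = size (wrap j c))%N.
    apply: (recurrence_period _ _ _ _ _ w_per wc); last by rewrite Es.
    exact: has_wrap.
  by rewrite /wrap !size_cat size_nseq size_drop size_takel sz_c ?subnK // addnC.
have w_per' t : w (t + (ell + (q + r)))%N = w t by rewrite !addnA w_perr -addnA.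
by split=> //; apply/conv_insert0; rewrite ?sz_c ?sz_d.
Qed.

(** * Transposition, the code dimension and the CSS condition *)

Definition opp_perm (s : nat) : {perm 'I_s.+1} := perm (@oppr_inj 'I_s.+1).

(** The entry of [A] at (-i, -k) has index -i + k, as has the entry of [A^T] at (i, k). *)
Lemma trmx_circulant s c (A := circulant_mx s.+1 c) (p := opp_perm s) :
  A^T = perm_mx p *m A *m perm_mx p^-1.
Proof.
apply/matrixP => i k; rewrite -row_permE -col_permE mxE 2![RHS]mxE.
rewrite !circulant_mxE !permE. by rewrite opprK addrC.
Qed.

Lemma rank_css_HZ s c d (Q := gb_code (circ_code s c d)) :
  \rank (css_HZ Q) = \rank (css_HX Q).
Proof.
rewrite /Q {Q}; case: s => [|s] /=.
  by rewrite !flatmx0.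
rewrite !trmx_circulant -!mulmxA -mul_mx_row.
set p := opp_perm s; set A := circulant_mx _ c; set B := circulant_mx _ d.
rewrite eqmxMfull ?row_full_unit ?unitmx_perm //.
(* The remaining factor swaps the two blocks and permutes the columns inside each, hence is
   invertible. *)
rewrite (_ : row_mx _ _ = row_mx A B *m
    block_mx 0 (perm_mx p^-1) (perm_mx p^-1) 0); last first.
  by rewrite mul_row_block !mulmx0 add0r addr0.
apply: mxrankMfree; apply/row_freeP.
exists (block_mx 0 (perm_mx p) (perm_mx p) 0).
rewrite mulmx_block !mul0mx !mulmx0 !addr0 !add0r -perm_mxM mulVg perm_mx1.
by rewrite -scalar_mx_block.
Qed.

(** The length is 2s and both blocks have the rank of [css_HX Q], which has s rows; 2s minus twice
    this rank is twice the dimension of the left kernel. *)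
Lemma css_dim_code s c d (Q := gb_code (circ_code s c d)) :
  css_dim Q = (2 * \rank (kermx (css_HX Q)))%N.
Proof.
rewrite /css_dim /parity_check rank_diag_block_mx rank_css_HZ mxrank_ker /=.
by rewrite mulnBr !mul2n -!addnn.
Qed.

Lemma gb_code_css s c d : css_condition (gb_code (circ_code s c d)).
Proof.
rewrite /css_condition /= tr_row_mx !trmxK mul_row_col.
case: s => [|s]; first by apply/matrixP => -[].
apply/matrixP => i k; rewrite !mxE.
(* The product is AB + BA. Circulants commute, by the substitution of i + k - l for l, and the two
   equal terms cancel in characteristic 2. *)
have -> : \sum_l circulant_mx s.+1 d i l * circulant_mx s.+1 c l k =
          \sum_l circulant_mx s.+1 c i l * circulant_mx s.+1 d l k.
  rewrite (reindex_inj (subrI (i + k))) /=; apply: eq_bigr => l _.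
  rewrite !circulant_mxE mulrC opprB addrCA opprD addNKr.
  by rewrite addrAC addrK.
exact: F2_addrr.
Qed.

(** * Row and column weights of the parity-check matrix *)

Lemma card_nonzero n (f : 'I_n -> 'F_2) :
  #|[set k | f k != 0]| = (\sum_k (f k != 0%R))%N.
Proof. by rewrite cardsE -sum1_card big_mkcond. Qed.

Lemma sum_nonzero_seq (c : seq 'F_2) :
  (\sum_(u < size c) (c`_u != 0)%R)%N = count (fun x => x != 0) c.
Proof. by rewrite -sum1_count (big_nth 0) [RHS]big_mkcond big_mkord. Qed.

Lemma circulant_row_weight s c (i : 'I_s) : size c = s ->
  (\sum_k (circulant_mx s c i k != 0%R))%N = count (fun x => x != 0) c.
Proof.
case: s i => [[]//|s] i sz_c; rewrite -sum_nonzero_seq sz_c.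
rewrite (reindex_inj (subrI i)); apply: eq_bigr => k _.
by rewrite circulant_mxE subKr.
Qed.

Lemma circulant_col_weight s c (k : 'I_s) : size c = s ->
  (\sum_i (circulant_mx s c i k != 0%R))%N = count (fun x => x != 0) c.
Proof.
case: s k => [[]//|s] k sz_c; rewrite -sum_nonzero_seq sz_c.
rewrite (reindex_inj (addIr k)); apply: eq_bigr => i _.
by rewrite circulant_mxE addrK.
Qed.

Lemma sum_nonzero0 n (f : 'I_n -> 'F_2) : (forall k, f k = 0) ->
  (\sum_k (f k != 0%R))%N = 0%N.
Proof. by move=> f0; rewrite big1 // => k _; rewrite f0 eqxx. Qed.

Lemma row_neq0 p q (H : 'M['F_2]_(p, q)) i :
  (row i H != 0) = (0 < #|[set k | H i k != 0%R]|)%N.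
Proof.
rewrite lt0n; congr (~~ _); rewrite cards_eq0; apply/eqP/eqP => [Hi0|H0].
  by apply/setP => k; rewrite !inE; move/rowP/(_ k): Hi0; rewrite !mxE => ->.
apply/rowP => k; rewrite !mxE; apply/eqP.
by move/setP/(_ k): H0; rewrite !inE => /negbFE.
Qed.

Lemma col_neq0 p q (H : 'M['F_2]_(p, q)) k :
  (col k H != 0) = (0 < #|[set i | H i k != 0%R]|)%N.
Proof.
rewrite -trmx_eq0 tr_col row_neq0; congr (0 < #|pred_of_set _|)%N.
by apply/setP => i; rewrite !inE mxE.
Qed.

Section CodeWeights.

Variables (s : nat) (c d : seq 'F_2).
Hypotheses (sz_c : size c = s) (sz_d : size d = s).

Let H := parity_check (gb_code (circ_code s c d)).
Let wc := count (fun x => x != 0) c.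
Let wd := count (fun x => x != 0) d.

Lemma code_row_weight i : #|[set k | H i k != 0]| = (wc + wd)%N.
Proof.
rewrite card_nonzero !big_split_ord /= /H /parity_check /=.
rewrite -(splitK i); case: (split i) => {}i /=.
  rewrite ![X in (_ + (X + _))%N]sum_nonzero0 ?[X in (_ + (_ + X))%N]sum_nonzero0;
    try by move=> k; rewrite block_mxEur mxE.
  rewrite !addn0; congr (_ + _)%N.
    rewrite -[RHS](circulant_row_weight s c i sz_c); apply: eq_bigr => k _.
    by rewrite block_mxEul row_mxEl.
  rewrite -[RHS](circulant_row_weight s d i sz_d); apply: eq_bigr => k _.
  by rewrite block_mxEul row_mxEr.
rewrite ![X in ((X + _) + _)%N]sum_nonzero0 ?[X in ((_ + X) + _)%N]sum_nonzero0;
  try by move=> k; rewrite block_mxEdl mxE.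
rewrite [LHS]add0n [RHS]addnC; congr (_ + _)%N.
  rewrite -[RHS](circulant_col_weight s d i sz_d); apply: eq_bigr => k _.
  by rewrite block_mxEdr row_mxEl mxE.
rewrite -[RHS](circulant_col_weight s c i sz_c); apply: eq_bigr => k _.
by rewrite block_mxEdr row_mxEr mxE.
Qed.

(** In the Z block a column is a row of B or of A, which is why the roles of [wc] and [wd] are
    exchanged there. *)
Lemma code_col_weight (k : 'I_s) :
  let wt l := #|[set i | H i l != 0]| in
  [/\ wt (lshift _ (lshift s k)) = wc, wt (lshift _ (rshift s k)) = wd,
      wt (rshift _ (lshift s k)) = wd & wt (rshift _ (rshift s k)) = wc].
Proof.
have cA := circulant_col_weight s c k sz_c.
have cB := circulant_col_weight s d k sz_d.
have rA := circulant_row_weight s c k sz_c.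
have rB := circulant_row_weight s d k sz_d.
split; rewrite card_nonzero big_split_ord /= /H /parity_check /=.
- rewrite [X in (_ + X)%N]sum_nonzero0; last by move=> i; rewrite block_mxEdl mxE.
  by rewrite addn0 -[RHS]cA; apply: eq_bigr => i _; rewrite block_mxEul row_mxEl.
- rewrite [X in (_ + X)%N]sum_nonzero0; last by move=> i; rewrite block_mxEdl mxE.
  by rewrite addn0 -[RHS]cB; apply: eq_bigr => i _; rewrite block_mxEul row_mxEr.
- rewrite [X in (X + _)%N]sum_nonzero0; last by move=> i; rewrite block_mxEur mxE.
  by rewrite -[RHS]rB; apply: eq_bigr => i _; rewrite block_mxEdr row_mxEl mxE.
rewrite [X in (X + _)%N]sum_nonzero0; last by move=> i; rewrite block_mxEur mxE.
by rewrite -[RHS]rA; apply: eq_bigr => i _; rewrite block_mxEdr row_mxEr mxE.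
Qed.

Lemma code_col_weight_or l :
  let w := #|[set i | H i l != 0]| in w = wc \/ w = wd.
Proof.
rewrite -(splitK l); case: (split l) => {}l /=; rewrite -(splitK l);
case: (split l) => k; have [? ? ? ?] := code_col_weight k; by [left | right].
Qed.

(** This turns the assumption on the first code into a condition on coefficients, which survives the
    insertion of zeros. *)
Lemma code_wt_gt0 : (0 < s)%N -> no_zero_col H -> (0 < wc)%N && (0 < wd)%N.
Proof.
move=> s_gt0 nz_col; pose k : 'I_s := Ordinal s_gt0.
have [<- <- _ _] := code_col_weight k.
by rewrite -!col_neq0 !nz_col.
Qed.

Lemma code_density : (0 < wc)%N -> (0 < wd)%N ->
  [/\ no_zero_row H, no_zero_col H, (max_row_weight H <= wc + wd)%N
    & (max_col_weight H <= maxn wc wd)%N].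
Proof.
move=> wc_gt0 wd_gt0; split.
- by move=> i; rewrite row_neq0 code_row_weight addn_gt0 wc_gt0.
- by move=> l; rewrite col_neq0; case: (code_col_weight_or l) => ->.
- by apply/bigmax_leqP => i _; rewrite code_row_weight.
apply/bigmax_leqP => l _.
by case: (code_col_weight_or l) => ->; rewrite leq_max leqnn ?orbT.
Qed.

End CodeWeights.

(** [Poly] drops trailing zeros of the first column, which do not count towards the weight. *)
Lemma wt_poly_circ s (C : 'M['F_2]_s) :
  wt_poly (circ_poly C) = count (fun x => x != 0) (first_col C).
Proof.
rewrite /wt_poly /circ_poly; elim: (first_col C) => [|x e IHe] /=.
  by rewrite polyseqC eqxx.
rewrite polyseq_cons; case: ifP => [_|/negbFE/nilP e0] /=; first by rewrite IHe.
by rewrite -IHe e0 polyseqC count_nseq mulnbl addn0; case: (x != 0).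
Qed.

(** * Construction of the family and its parameters *)

Theorem theorem7 (ell M j : nat) (A1 B1 : 'M['F_2]_ell)
    (hM : (1 <= M)%N) (hj : (0 < j < ell - 1)%N)
    (hA : is_circulant A1) (hB : is_circulant B1)
    (hrow : no_zero_row (parity_check (gb_code (CircPair A1 B1))))
    (hcol : no_zero_col (parity_check (gb_code (CircPair A1 B1)))) :
  let a := circ_poly A1 in
  let b := circ_poly B1 in
  let t : rat := (wt_poly a + wt_poly b)%:R in
  exists (r : nat) (P : nat -> circ_pair)
         (n k : nat -> nat) (d : nat -> option nat),
    let Q m := gb_code (P m) in
    [/\ (0 < r)%N /\ P 1%N = CircPair A1 B1,
        forall m, (1 <= m <= M)%N ->
          css_condition (Q m) /\ has_parameters (Q m) (n m) (k m) (d m),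
        forall m, (1 <= m < M)%N ->
          n m.+1 = (2 * ell + 2 * m * r)%N /\ (k m <= k m.+1)%N,
        forall m, (1 <= m < M)%N -> P m.+1 = circ_pair_extend j r (P m)
      & qldpc M Q t /\ (wt_poly a = wt_poly b -> qldpc_common M Q t)].
Proof.
move=> a b t.
set c := first_col A1; set d := first_col B1.
have ell_gt0 : (0 < ell)%N by case: (ell) hj => //; rewrite ltn0 andbF.
have le_j : (j <= ell)%N.
  by case/andP: hj => _ /ltnW /leq_trans; apply; apply: leq_subr.
have sz_c : size c = ell by apply: size_first_col.
have sz_d : size d = ell by apply: size_first_col.
have E1 : CircPair A1 B1 = circ_code ell c d.
  by rewrite /circ_code -!is_circulantE.
(* This [r] depends on [ell] and [j] only, so one value serves every step of the family. *)
pose r := common_period (ell + j).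
pose P m := iter m.-1 (circ_pair_extend j r) (CircPair A1 B1).
have PE m : P m = circ_code (ell + m.-1 * r) (insert0 j (m.-1 * r) c)
                            (insert0 j (m.-1 * r) d).
  by rewrite /P E1 iter_circ_pair_extend.
have PS m : (0 < m)%N -> P m.+1 = circ_pair_extend j r (P m) by case: m.
have /andP[wc_gt0 wd_gt0] : (0 < wt_poly a)%N && (0 < wt_poly b)%N.
  rewrite !wt_poly_circ; apply: (code_wt_gt0 ell) => //.
  by move: hcol; rewrite E1.
have t_gt0 : 0 < t by rewrite ltr0n addn_gt0 wc_gt0.
have dens m : [/\ (0 < css_rows (gb_code (P m)))%N,
    css_length (gb_code (P m)) = (2 * css_rows (gb_code (P m)))%N &
    let H := parity_check (gb_code (P m)) in
    [/\ no_zero_row H, no_zero_col H,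
        (max_row_weight H <= wt_poly a + wt_poly b)%N
      & (max_col_weight H <= maxn (wt_poly a) (wt_poly b))%N]].
  rewrite PE; split; first by rewrite /= addn_gt0 ell_gt0.
    by rewrite /= mul2n addnn.
  rewrite !wt_poly_circ -/c -/d.
  rewrite -(count_insert0 j (m.-1 * r) c) -(count_insert0 j (m.-1 * r) d).
  apply: code_density; rewrite ?size_insert0 ?sz_c ?sz_d //.
    by rewrite count_insert0 -wt_poly_circ.
  by rewrite count_insert0 -wt_poly_circ.
exists r, P, (fun m => css_length (gb_code (P m))),
  (fun m => css_dim (gb_code (P m))), (fun m => css_distance (gb_code (P m))).
move=> Q; split.
- by split=> //; apply: fact_gt0.
- by move=> m _; split=> //; rewrite /Q PE; apply: gb_code_css.
- move=> m /andP[m_gt0 _]; split; first by rewrite PE /= addnn -mul2n mulnDr mulnA.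
  rewrite !PE !css_dim_code leq_mul2l /=.
  rewrite -[in (m * r)%N](prednK m_gt0) mulSnr.
  by apply: rank_ker_insert0_le; rewrite // has_count -wt_poly_circ.
- by move=> m /andP[m_gt0 _]; apply: PS.
split=> [|wt_ab].
  (* Each density bound is [t] divided by the relevant dimension, so that both products equal
     [t]. *)
  split=> //; exists (fun m => t / (css_length (Q m))%:R),
    (fun m => t / (css_rows (Q m))%:R).
  split=> m _; have [rows_gt0 len nz] := dens m.
    case: nz => ? ? le_r le_c; split=> //.
      by rewrite ler_wpM2r ?invr_ge0 ?ler0n // ler_nat.
    rewrite ler_wpM2r ?invr_ge0 ?ler0n // ler_nat (leq_trans le_c) //.
    by rewrite geq_max leq_addr leq_addl.
  by rewrite !divfK // pnatr_eq0 -?lt0n // len muln_gt0.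
(* As the length is twice the number of rows, the column condition asks that twice the column weight
   be at most [t]; for equal weights [t] is exactly twice [wt_poly a]. *)
split=> //; exists (fun m => t / (css_length (Q m))%:R) => m _;
  have [rows_gt0 len nz] := dens m.
  case: nz => ? ? le_r le_c; split=> //.
    by rewrite ler_wpM2r ?invr_ge0 ?ler0n // ler_nat.
  rewrite [in leRHS]len natrM invfM mulrA ler_wpM2r ?invr_ge0 ?ler0n //.
  rewrite ler_pdivlMr ?ltr0n // -natrM ler_nat.
  rewrite -wt_ab maxnn in le_c *.
  by rewrite [leqRHS]addnn -muln2 leq_mul2r.
have rows_neq0 : (css_rows (Q m))%:R != 0 :> rat by rewrite pnatr_eq0 -lt0n.
split; first by rewrite divfK // pnatr_eq0 -lt0n len muln_gt0.
rewrite len natrM invfM mulrA divfK // ler_pdivrMr ?ltr0n // ler_peMr ?ler1n //.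
Qed.
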